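(* Let $\mathcal A$ be a pointed regular category and let $F\colon\mathbb A\to\mathbb B$ be a functor between groupoids in $\mathcal A$. Let $K_F\colon\mathbb K\mathrm{er}(F)\to\mathbb A$ be the kernel of $F$ and let $(\mathbb K(F),\ K(F)\colon\mathbb K(F)\to\mathbb A,\ k(F)\colon 0\Rightarrow K(F)\cdot F)$ be the strong h-kernel of $F$ in $\mathbf{Grpd}(\mathcal A)$. Let $J\colon\mathbb K\mathrm{er}(F)\to\mathbb K(F)$ be the canonical comparison, i.e. the unique functor with $J\cdot K(F)=K_F$ and $J\cdot k(F)=\mathrm{id}$. Then: \begin{enumerate} \item $F$ is a $\ast$-fibration if and only if $J$ is a weak equivalence. \item $F$ is a split epi $\ast$-fibration if and only if $J$ is an equivalence. \end{enumerate}
   Context: Composition is written diagrammatically: $f\cdot g$ means first $f$, then $g$. Pointed means having a zero object $0$. For an arrow $f$, $k_f\colon\mathrm{Ker}(f)\to\cdot$ denotes its kernel. **Internal groupoids.** A groupoid $\mathbb B$ in $\mathcal A$ has object of objects $B_0$, object of arrows $B_1$, domain and codomain $d,c\colon B_1\rightrightarrows B_0$, identities $e\colon B_0\to B_1$, composition $m\colon B_1\times_{c,d}B_1\to B_1$ (where $B_1\times_{c,d}B_1$ has projections $\pi_1,\pi_2$ with $\pi_1\cdot c=\pi_2\cdot d$) and inverse $i\colon B_1\to B_1$, satisfying the usual axioms. A functor $F\colon\mathbb A\to\mathbb B$ is a pair $(F_0\colon A_0\to B_0,\ F_1\colon A_1\to B_1)$ compatible with the structure. A natural transformation $\alpha\colon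 F\Rightarrow G\colon\mathbb A\rightrightarrows\mathbb B$ is an arrow $\alpha\colon A_0\to B_1$ with $\alpha\cdot d=F_0$, $\alpha\cdot c=G_0$ and $\langle d\cdot\alpha,G_1\rangle\cdot m=\langle F_1,c\cdot\alpha\rangle\cdot m$. These form the 2-category $\mathbf{Grpd}(\mathcal A)$, in which all 2-cells are invertible. Limits in its underlying category, in particular kernels, are level-wise. $[0]$ is the zero groupoid, and $0$ also denotes functors factoring through $[0]$. **Strong h-pullback and strong h-kernel.** A strong h-pullback of $F\colon\mathbb A\to\mathbb B$ and $G\colon\mathbb C\to\mathbb B$ consists of an object $\mathbb P$, 1-cells $G'\colon\mathbb P\to\mathbb A$, $F'\colon\mathbb P\to\mathbb C$ and a 2-cell $\varphi\colon F'\cdot G\Rightarrow G'\cdot F$ such that: (a) for all $H\colon\mathbb X\to\mathbb A$, $K\colon\mathbb X\to\mathbb C$ and $\mu\colon K\cdot G\Rightarrow H\cdot F$ there is a unique $T\colon\mathbb X\to\mathbb P$ with $T\cdot G'=H$, $T\cdot F'=K$, $T\cdot\varphi=\mu$; (b) for all $L,M\colon\mathbb X\rightrightarrows\mathbb P$ and 2-cells $\alpha\colon L\cdot F'\Rightarrow M\cdot F'$, $\beta\colon L\cdot G'\Rightarrow M\cdot G'$ such that ($L\cdot\varphi$ followed by $\beta\cdot F$) equals ($\alpha\cdot G$ followed by $M\cdot\varphi$), there is a unique $\mu\colon L\Rightarrow M$ with $\mu\cdot F'=\alpha$ and $\mu\cdot G'=\beta$. The strong h-kernel of $F$ is the strong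 h-pullback of $F$ and $0\colon[0]\to\mathbb B$; it exists in $\mathbf{Grpd}(\mathcal A)$. **Classes of functors.** Let $F\colon\mathbb A\to\mathbb B$ be a functor. - Let $F_1^c\colon\mathrm{Ker}(F_1\cdot c)\to\mathrm{Ker}(c)$ be determined by $F_1^c\cdot k_c=k_{F_1\cdot c}\cdot F_1$ (here $c\colon B_1\to B_0$), let $A_0\times_{F_0,k_c\cdot d}\mathrm{Ker}(c)$ be the pullback of $F_0$ and $k_c\cdot d\colon\mathrm{Ker}(c)\to B_0$, and let $\widehat\tau_d\colon\mathrm{Ker}(F_1\cdot c)\to A_0\times_{F_0,k_c\cdot d}\mathrm{Ker}(c)$ be the arrow with components $k_{F_1\cdot c}\cdot d$ and $F_1^c$. $F$ is a $\ast$-fibration (respectively a split epi $\ast$-fibration) if $\widehat\tau_d$ is a regular epimorphism (respectively a split epimorphism). (Equivalently one may exchange the roles of $d$ and $c$.) - $F$ is fully faithful if $(d,F_1,c)$ exhibits $A_1$ as the limit of $A_0\xrightarrow{F_0}B_0\xleftarrow{d}B_1\xrightarrow{c}B_0\xleftarrow{F_0}A_0$. - Let $\beta_d\colon A_0\times_{F_0,d}B_1\to B_1$ be the projection of the pullback of $F_0$ and $d$. $F$ is essentially surjective if $\beta_d\cdot c\colon A_0\times_{F_0,d}B_1\to B_0$ is a regular epimorphism. - $F$ is a weak equivalence if it is fully faithful and essentially surjective. - $F$ is an equivalence if it is an equivalence in the 2-category $\mathbf{Grpd}(\mathcal A)$; equivalently, it is fully faithful and $\beta_d\cdot c$ is a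 split epimorphism. *)

(* Defs.v *)
Set Implicit Arguments.
Unset Strict Implicit.
Unset Printing Implicit Defensive.

Declare Scope cat_scope.
Delimit Scope cat_scope with cat.
Local Open Scope cat_scope.

(** ** Categories *)

(* Composition is diagrammatic: [f · g] is first [f], then [g]. *)
Reserved Notation "f · g" (at level 40, left associativity).

Record Category := {
  Ob :> Type;
  Hom : Ob -> Ob -> Type;
  idm : forall X, Hom X X;
  comp : forall X Y Z, Hom X Y -> Hom Y Z -> Hom X Z
    where "f · g" := (comp f g);
  comp_id_l : forall X Y (f : Hom X Y), idm X · f = f;
  comp_id_r : forall X Y (f : Hom X Y), f · idm Y = f;
  comp_assoc : forall W X Y Z (f : Hom W X) (g : Hom X Y) (h : Hom Y Z),
    (f · g) · h = f · (g · h)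
}.
Arguments Hom {c} X Y.
Arguments idm {c} X.
Arguments comp {c X Y Z} f g.
Arguments comp_assoc {c W X Y Z} f g h.
Notation "f · g" := (comp f g) : cat_scope.

Record Pullback (C : Category) (X Y Z : C) (f : Hom X Z) (g : Hom Y Z) := {
  pb_ob : C;
  pb_fst : Hom pb_ob X;
  pb_snd : Hom pb_ob Y;
  pb_square : pb_fst · f = pb_snd · g;
  pb_pair : forall (W : C) (x : Hom W X) (y : Hom W Y),
    x · f = y · g -> Hom W pb_ob;
  pb_pair_fst : forall (W : C) (x : Hom W X) (y : Hom W Y) (H : x · f = y · g),
    pb_pair H · pb_fst = x;
  pb_pair_snd : forall (W : C) (x : Hom W X) (y : Hom W Y) (H : x · f = y · g),
    pb_pair H · pb_snd = y;
  pb_unique : forall (W : C) (u v : Hom W pb_ob),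
    u · pb_fst = v · pb_fst -> u · pb_snd = v · pb_snd -> u = v
}.

(* A zero object and pullbacks: together they give all finite limits. *)
Record PointedLexCategory := {
  plex_cat :> Category;
  zero_ob : plex_cat;
  to_zero : forall X : plex_cat, Hom X zero_ob;
  to_zero_unique : forall (X : plex_cat) (f : Hom X zero_ob), f = to_zero X;
  from_zero : forall X : plex_cat, Hom zero_ob X;
  from_zero_unique : forall (X : plex_cat) (f : Hom zero_ob X), f = from_zero X;
  pullback : forall (X Y Z : plex_cat) (f : Hom X Z) (g : Hom Y Z), Pullback f g
}.
Arguments zero_ob {_}.
Arguments to_zero {_} X.
Arguments from_zero {_} X.

Section Arrows.
Variable C : PointedLexCategory.

Definition PB (X Y Z : C) (f : Hom X Z) (g : Hom Y Z) : C :=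
  pb_ob (pullback f g).
Definition pr1 (X Y Z : C) (f : Hom X Z) (g : Hom Y Z) : Hom (PB f g) X :=
  pb_fst (pullback f g).
Definition pr2 (X Y Z : C) (f : Hom X Z) (g : Hom Y Z) : Hom (PB f g) Y :=
  pb_snd (pullback f g).
Definition pair (X Y Z : C) (f : Hom X Z) (g : Hom Y Z)
    (W : C) (x : Hom W X) (y : Hom W Y) (H : x · f = y · g) : Hom W (PB f g) :=
  pb_pair (pullback f g) H.

Lemma pr_square (X Y Z : C) (f : Hom X Z) (g : Hom Y Z) :
  pr1 f g · f = pr2 f g · g.
Proof. exact (pb_square (pullback f g)). Qed.

Lemma pair_pr1 (X Y Z : C) (f : Hom X Z) (g : Hom Y Z)
  (W : C) (x : Hom W X) (y : Hom W Y) (H : x · f = y · g) : pair H · pr1 f g = x.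
Proof. exact (pb_pair_fst _ H). Qed.

Lemma pair_pr2 (X Y Z : C) (f : Hom X Z) (g : Hom Y Z)
  (W : C) (x : Hom W X) (y : Hom W Y) (H : x · f = y · g) : pair H · pr2 f g = y.
Proof. exact (pb_pair_snd _ H). Qed.

Lemma PB_unique (X Y Z : C) (f : Hom X Z) (g : Hom Y Z)
  (W : C) (u v : Hom W (PB f g)) :
  u · pr1 f g = v · pr1 f g -> u · pr2 f g = v · pr2 f g -> u = v.
Proof. exact (@pb_unique _ _ _ _ _ _ (pullback f g) W u v). Qed.

Definition zero (X Y : C) : Hom X Y := to_zero X · from_zero Y.

(* The kernel of [f] is the pullback of [f] along [0 -> Y]. *)
Definition Ker (X Y : C) (f : Hom X Y) : C := PB f (from_zero Y).
Definition ker (X Y : C) (f : Hom X Y) : Hom (Ker f) X := pr1 f (from_zero Y).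
Definition ker_lift (X Y : C) (f : Hom X Y) (W : C) (x : Hom W X)
    (H : x · f = zero W Y) : Hom W (Ker f) :=
  @pair _ _ _ f (from_zero Y) W x (to_zero W) H.

Lemma to_zero_eq (X : C) (f g : Hom X zero_ob) : f = g.
Proof. rewrite (to_zero_unique f). symmetry. apply to_zero_unique. Qed.

Lemma from_zero_eq (X : C) (f g : Hom zero_ob X) : f = g.
Proof. rewrite (from_zero_unique f). symmetry. apply from_zero_unique. Qed.

Lemma ker_lift_ker (X Y : C) (f : Hom X Y) (W : C) (x : Hom W X)
  (H : x · f = zero W Y) : ker_lift H · ker f = x.
Proof. exact (pb_pair_fst _ H). Qed.

Lemma zero_l (X Y Z : C) (f : Hom Y Z) : zero X Y · f = zero X Z.
Proof.
  unfold zero. rewrite comp_assoc. f_equal. apply from_zero_unique.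
Qed.

Lemma zero_r (X Y Z : C) (f : Hom X Y) : f · zero Y Z = zero X Z.
Proof.
  unfold zero. rewrite <- comp_assoc. f_equal. apply to_zero_unique.
Qed.

Lemma ker_zero (X Y : C) (f : Hom X Y) : ker f · f = zero (Ker f) Y.
Proof.
  transitivity (pr2 f (from_zero Y) · from_zero Y).
  - exact (pr_square _ _).
  - unfold zero. f_equal. apply to_zero_unique.
Qed.

Definition IsCoequalizer (X Y Q : C) (u v : Hom X Y) (q : Hom Y Q) : Prop :=
  u · q = v · q /\
  forall (W : C) (h : Hom Y W), u · h = v · h -> exists! t : Hom Q W, q · t = h.

Definition RegularEpi (Y Q : C) (q : Hom Y Q) : Prop :=
  exists (X : C) (u v : Hom X Y), IsCoequalizer u v q.

Definition SplitEpi (X Y : C) (f : Hom X Y) : Prop :=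
  exists s : Hom Y X, s · f = idm Y.

End Arrows.

(* Finite limits are already part of [PointedLexCategory]. *)
Record IsRegular (C : PointedLexCategory) : Prop := {
  kernel_pair_coequalizer : forall (X Y : C) (f : Hom X Y),
    exists (Q : C) (q : Hom X Q), IsCoequalizer (pr1 f f) (pr2 f f) q;
  regular_epi_stable : forall (X Y Z : C) (f : Hom X Z) (g : Hom Y Z),
    RegularEpi f -> RegularEpi (pr2 f g)
}.

(** ** Internal groupoids *)

(* Compatibility conditions needed to form the pairings in the axioms of an
   internal groupoid. *)
Section Composability.
Variables (C : PointedLexCategory) (B0 B1 : C) (d c : Hom B1 B0).

Lemma composable_mul_l (m : Hom (PB c d) B1) (mc : m · c = pr2 c d · c)
  (X : C) (f g h : Hom X B1) (fg : f · c = g · d) (gh : g · c = h · d) :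
  (pair fg · m) · c = h · d.
Proof.
  rewrite comp_assoc, mc, <- comp_assoc, pair_pr2. exact gh.
Qed.

Lemma composable_mul_r (m : Hom (PB c d) B1) (md : m · d = pr1 c d · d)
  (X : C) (f g h : Hom X B1) (fg : f · c = g · d) (gh : g · c = h · d) :
  f · c = (pair gh · m) · d.
Proof.
  rewrite comp_assoc, md, <- comp_assoc, pair_pr1. exact fg.
Qed.

Lemma composable_id_l (e : Hom B0 B1) (ec : e · c = idm B0) :
  (d · e) · c = idm B1 · d.
Proof. rewrite comp_assoc, ec, comp_id_l, comp_id_r. reflexivity. Qed.

Lemma composable_id_r (e : Hom B0 B1) (ed : e · d = idm B0) :
  idm B1 · c = (c · e) · d.
Proof. rewrite comp_assoc, ed, comp_id_l, comp_id_r. reflexivity. Qed.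

Lemma composable_inv_l (i : Hom B1 B1) (ic : i · c = d) : i · c = idm B1 · d.
Proof. rewrite ic, comp_id_l. reflexivity. Qed.

Lemma composable_inv_r (i : Hom B1 B1) (id : i · d = c) : idm B1 · c = i · d.
Proof. rewrite id, comp_id_l. reflexivity. Qed.

End Composability.

(* Associativity is stated on generalized elements [f, g, h : X -> B1]. *)
Record Groupoid (C : PointedLexCategory) := {
  ob0 : C;
  ob1 : C;
  dom : Hom ob1 ob0;
  cod : Hom ob1 ob0;
  unt : Hom ob0 ob1;
  mul : Hom (PB cod dom) ob1;
  inv : Hom ob1 ob1;
  unt_dom : unt · dom = idm ob0;
  unt_cod : unt · cod = idm ob0;
  mul_dom : mul · dom = pr1 cod dom · dom;
  mul_cod : mul · cod = pr2 cod dom · cod;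
  mul_assoc : forall (X : C) (f g h : Hom X ob1)
    (fg : f · cod = g · dom) (gh : g · cod = h · dom),
    pair (composable_mul_l mul_cod fg gh) · mul =
    pair (composable_mul_r mul_dom fg gh) · mul;
  mul_unt_l : pair (composable_id_l dom unt_cod) · mul = idm ob1;
  mul_unt_r : pair (composable_id_r cod unt_dom) · mul = idm ob1;
  inv_dom : inv · dom = cod;
  inv_cod : inv · cod = dom;
  mul_inv_l : pair (composable_inv_l inv_cod) · mul = cod · unt;
  mul_inv_r : pair (composable_inv_r inv_dom) · mul = dom · unt
}.
Arguments dom {C} _.
Arguments cod {C} _.
Arguments unt {C} _.
Arguments mul {C} _.
Arguments inv {C} _.

Section Grpd.
Variable C : PointedLexCategory.

(* The composite of the generalized elements [f] and [g] of [B1]. *)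
Definition gcomp (B : Groupoid C) (X : C) (f g : Hom X (ob1 B))
    (fg : f · cod B = g · dom B) : Hom X (ob1 B) :=
  pair fg · mul B.

Lemma composable_functor (A B : Groupoid C)
  (F0 : Hom (ob0 A) (ob0 B)) (F1 : Hom (ob1 A) (ob1 B))
  (Fd : F1 · dom B = dom A · F0) (Fc : F1 · cod B = cod A · F0) :
  (pr1 (cod A) (dom A) · F1) · cod B = (pr2 (cod A) (dom A) · F1) · dom B.
Proof.
  rewrite !comp_assoc, Fd, Fc, <- !comp_assoc. f_equal. apply pr_square.
Qed.

Record Functor (A B : Groupoid C) := {
  fun0 : Hom (ob0 A) (ob0 B);
  fun1 : Hom (ob1 A) (ob1 B);
  fun_dom : fun1 · dom B = dom A · fun0;
  fun_cod : fun1 · cod B = cod A · fun0;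
  fun_unt : unt A · fun1 = fun0 · unt B;
  fun_mul : mul A · fun1 = gcomp (composable_functor fun_dom fun_cod);
  fun_inv : inv A · fun1 = fun1 · inv B
}.

(* A functor is the pair of its two components. *)
Definition eq_functor (A B : Groupoid C) (F G : Functor A B) : Prop :=
  fun0 F = fun0 G /\ fun1 F = fun1 G.

Definition id_functor (A : Groupoid C) : Functor A A.
Proof.
  refine {| fun0 := idm (ob0 A); fun1 := idm (ob1 A) |}.
  Unshelve.
  all: try (rewrite comp_id_l, comp_id_r; reflexivity).
  unfold gcomp. transitivity (idm (PB (cod A) (dom A)) · mul A).
  - rewrite comp_id_l, comp_id_r. reflexivity.
  - f_equal. apply PB_unique.
    + rewrite pair_pr1, comp_id_l, comp_id_r. reflexivity.
    + rewrite pair_pr2, comp_id_l, comp_id_r. reflexivity.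
Defined.

Lemma comp_functor_dom (A B D : Groupoid C) (F : Functor A B) (G : Functor B D) :
  (fun1 F · fun1 G) · dom D = dom A · (fun0 F · fun0 G).
Proof. rewrite comp_assoc, fun_dom, <- comp_assoc, fun_dom, comp_assoc. reflexivity. Qed.

Lemma comp_functor_cod (A B D : Groupoid C) (F : Functor A B) (G : Functor B D) :
  (fun1 F · fun1 G) · cod D = cod A · (fun0 F · fun0 G).
Proof. rewrite comp_assoc, fun_cod, <- comp_assoc, fun_cod, comp_assoc. reflexivity. Qed.

Definition comp_functor (A B D : Groupoid C) (F : Functor A B) (G : Functor B D) :
  Functor A D.
Proof.
  refine {| fun0 := fun0 F · fun0 G; fun1 := fun1 F · fun1 G;
            fun_dom := comp_functor_dom F G; fun_cod := comp_functor_cod F G |}.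
  - rewrite <- comp_assoc, fun_unt, comp_assoc, fun_unt, comp_assoc. reflexivity.
  - rewrite <- comp_assoc, fun_mul. unfold gcomp. rewrite comp_assoc, fun_mul.
    unfold gcomp. rewrite <- comp_assoc. f_equal. apply PB_unique.
    + rewrite comp_assoc, !pair_pr1, <- comp_assoc, pair_pr1, comp_assoc. reflexivity.
    + rewrite comp_assoc, !pair_pr2, <- comp_assoc, pair_pr2, comp_assoc. reflexivity.
  - rewrite <- comp_assoc, fun_inv, comp_assoc, fun_inv, comp_assoc. reflexivity.
Defined.

Definition zero_groupoid : Groupoid C.
Proof.
  unshelve refine {| ob0 := zero_ob; ob1 := zero_ob;
    dom := idm zero_ob; cod := idm zero_ob; unt := idm zero_ob;
    mul := to_zero (PB (idm zero_ob) (idm zero_ob)); inv := idm zero_ob |};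
  intros; apply to_zero_eq.
Defined.

Definition to_zero_functor (A : Groupoid C) : Functor A zero_groupoid.
Proof.
  unshelve refine {|
    fun0 := (to_zero (ob0 A) : Hom (ob0 A) (ob0 zero_groupoid));
    fun1 := (to_zero (ob1 A) : Hom (ob1 A) (ob1 zero_groupoid)) |};
  apply to_zero_eq.
Defined.

Definition from_zero_functor (B : Groupoid C) : Functor zero_groupoid B.
Proof.
  unshelve refine {|
    fun0 := (from_zero (ob0 B) : Hom (ob0 zero_groupoid) (ob0 B));
    fun1 := (from_zero (ob1 B) : Hom (ob1 zero_groupoid) (ob1 B)) |};
  try apply from_zero_eq.
  transitivity (zero (PB (cod zero_groupoid) (dom zero_groupoid)) (ob1 B));
    [reflexivity |].
  unfold gcomp. rewrite <- (zero_l _ (mul B)). f_equal. apply PB_unique.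
  - rewrite pair_pr1, zero_l. unfold zero. f_equal. apply to_zero_eq.
  - rewrite pair_pr2, zero_l. unfold zero. f_equal. apply to_zero_eq.
Defined.

Definition zero_functor (A B : Groupoid C) : Functor A B :=
  comp_functor (to_zero_functor A) (from_zero_functor B).

(** ** Natural transformations *)

Lemma composable_nat_l (A B : Groupoid C) (G : Functor A B)
  (a : Hom (ob0 A) (ob1 B)) (ac : a · cod B = fun0 G) :
  (dom A · a) · cod B = fun1 G · dom B.
Proof. rewrite comp_assoc, ac, fun_dom. reflexivity. Qed.

Lemma composable_nat_r (A B : Groupoid C) (F : Functor A B)
  (a : Hom (ob0 A) (ob1 B)) (ad : a · dom B = fun0 F) :
  fun1 F · cod B = (cod A · a) · dom B.
Proof. rewrite comp_assoc, ad, fun_cod. reflexivity. Qed.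

(* A 2-cell is its underlying arrow; equality of 2-cells is equality of the
   underlying arrows.  The arrow underlying the whiskering [L · a] is
   [fun0 L · a], that of [a · F] is [a · fun1 F], that of the identity of [F] is
   [fun0 F · unt B], and that of a vertical composite is given by [gcomp]. *)
Record NatTrans (A B : Groupoid C) (F G : Functor A B) := {
  nt_arr :> Hom (ob0 A) (ob1 B);
  nt_dom : nt_arr · dom B = fun0 F;
  nt_cod : nt_arr · cod B = fun0 G;
  nt_natural : gcomp (composable_nat_l nt_cod) = gcomp (composable_nat_r nt_dom)
}.

(** ** Kernels and strong h-kernels *)

Definition IsKernelFunctor (A B N : Groupoid C) (F : Functor A B)
    (K : Functor N A) : Prop :=
  eq_functor (comp_functor K F) (zero_functor N B) /\
  forall (X : Groupoid C) (H : Functor X A),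
    eq_functor (comp_functor H F) (zero_functor X B) ->
    exists T : Functor X N,
      eq_functor (comp_functor T K) H /\
      forall T' : Functor X N, eq_functor (comp_functor T' K) H -> eq_functor T' T.

Section StrongHPullback.
Variables (A B D P : Groupoid C) (F : Functor A B) (G : Functor D B).
Variables (G' : Functor P A) (F' : Functor P D).
Variable phi : NatTrans (comp_functor F' G) (comp_functor G' F).

Lemma composable_hpb_l (X : Groupoid C) (L M : Functor X P)
  (b : NatTrans (comp_functor L G') (comp_functor M G')) :
  (fun0 L · phi) · cod B = (b · fun1 F) · dom B.
Proof.
  rewrite !comp_assoc, nt_cod, fun_dom, <- !comp_assoc, nt_dom. simpl.
  rewrite !comp_assoc. reflexivity.
Qed.

Lemma composable_hpb_r (X : Groupoid C) (L M : Functor X P)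
  (a : NatTrans (comp_functor L F') (comp_functor M F')) :
  (a · fun1 G) · cod B = (fun0 M · phi) · dom B.
Proof.
  rewrite !comp_assoc, nt_dom, fun_cod, <- !comp_assoc, nt_cod. simpl.
  rewrite !comp_assoc. reflexivity.
Qed.

Definition IsStrongHPullback : Prop :=
  (forall (X : Groupoid C) (H : Functor X A) (K : Functor X D)
     (mu : NatTrans (comp_functor K G) (comp_functor H F)),
     let factors (T : Functor X P) :=
       eq_functor (comp_functor T G') H /\
       eq_functor (comp_functor T F') K /\
       fun0 T · phi = mu in
     exists T : Functor X P,
       factors T /\ forall T' : Functor X P, factors T' -> eq_functor T' T) /\
  (forall (X : Groupoid C) (L M : Functor X P)
     (a : NatTrans (comp_functor L F') (comp_functor M F'))
     (b : NatTrans (comp_functor L G') (comp_functor M G')),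
     gcomp (composable_hpb_l b) = gcomp (composable_hpb_r a) ->
     let factors (mu : NatTrans L M) :=
       mu · fun1 F' = a /\ mu · fun1 G' = b in
     exists mu : NatTrans L M,
       factors mu /\
       forall mu' : NatTrans L M, factors mu' -> nt_arr mu' = nt_arr mu).

End StrongHPullback.

Definition IsStrongHKernel (A B P : Groupoid C) (F : Functor A B)
    (K : Functor P A) (k : NatTrans (zero_functor P B) (comp_functor K F)) : Prop :=
  @IsStrongHPullback A B zero_groupoid P F (from_zero_functor B)
    K (to_zero_functor P) k.

(** ** Classes of functors *)

Section Fibrations.
Variables (A B : Groupoid C) (F : Functor A B).

Lemma ker_F1c_zero :
  (ker (fun1 F · cod B) · fun1 F) · cod B = zero (Ker (fun1 F · cod B)) (ob0 B).
Proof. rewrite comp_assoc. apply ker_zero. Qed.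

Definition F1c : Hom (Ker (fun1 F · cod B)) (Ker (cod B)) :=
  ker_lift ker_F1c_zero.

Lemma tau_d_square :
  (ker (fun1 F · cod B) · dom A) · fun0 F = F1c · (ker (cod B) · dom B).
Proof.
  rewrite <- (comp_assoc F1c). unfold F1c. rewrite ker_lift_ker.
  rewrite !comp_assoc, fun_dom. reflexivity.
Qed.

Definition tau_d :
    Hom (Ker (fun1 F · cod B)) (PB (fun0 F) (ker (cod B) · dom B)) :=
  pair tau_d_square.

Definition StarFibration : Prop := RegularEpi tau_d.

Definition SplitEpiStarFibration : Prop := SplitEpi tau_d.

Definition FullyFaithful : Prop :=
  forall (X : C) (x : Hom X (ob0 A)) (b : Hom X (ob1 B)) (y : Hom X (ob0 A)),
    x · fun0 F = b · dom B -> b · cod B = y · fun0 F ->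
    exists! u : Hom X (ob1 A), u · dom A = x /\ u · fun1 F = b /\ u · cod A = y.

Definition EssentiallySurjective : Prop :=
  RegularEpi (pr2 (fun0 F) (dom B) · cod B).

Definition WeakEquivalence : Prop := FullyFaithful /\ EssentiallySurjective.

(* All 2-cells are invertible, so their mere existence suffices. *)
Definition Equivalence : Prop :=
  exists G : Functor B A,
    inhabited (NatTrans (id_functor A) (comp_functor F G)) /\
    inhabited (NatTrans (comp_functor G F) (id_functor B)).

End Fibrations.
End Grpd.

(* Main.v *)
Require Import Defs.
Local Open Scope cat_scope.

(** Everything is read off generalized elements.  An arrow [X -> HKF0] is a pair
    of an object [a] of [A] and an arrow [b : 0 -> F a] of [B]; an arrow of the
    strong h-kernel from [(a, b)] to [(a', b')] is an arrow [h : a -> a'] with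
    [b · F h = b'].  The functor [J] sends [x] with [F x = 0] to [(x, id)].

    [J] is always fully faithful: an arrow [(x, id) -> (y, id)] is an [h] with
    [F h = id], that is, an arrow of the kernel ([comparison_fully_faithful]).

    An element of the pullback [Ker0 ×_{J0, dom} HKF1], on which essential
    surjectivity of [J] is tested, is an arrow [h : x -> a] with [F x = 0]; its
    image in [HKF0] is [(a, F h)].  An element of the domain of [tau_d] is an
    arrow [f : a -> x] with [F x = 0], and [tau_d] sends it to
    [(a, F f : F a -> 0)].  Inversion in [A] and in [B] exchanges these two
    descriptions, so [tau_d] and the arrow testing [J] are isomorphic in the
    category of arrows ([tau_d_isomorphic]).  Hence one is a regular (split)
    epimorphism exactly when the other is.  This gives the first equivalence,
    and the second follows because a fully faithful functor is an equivalence if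
    and only if its testing arrow splits ([split_of_equivalence],
    [equivalence_of_split]).

    The universal properties of the kernel and of the strong h-kernel only speak
    of groupoids.  Testing them on discrete groupoids gives the descriptions of
    the objects of both, and of the arrows of the strong h-kernel.  An arrow of
    the kernel would correspond to a functor out of [X] times an interval, which
    needs coproducts; instead the level-wise kernel is constructed and compared
    with the given one ([kernel_arrow_retraction]). *)

Set Implicit Arguments.
Unset Strict Implicit.

(** * Isomorphic arrows *)

Section IsomorphicArrows.
Variable C : PointedLexCategory.

Lemma square_assoc (X Y Y' Z W : C) (f : Hom X Y) (g : Hom Y Z)
  (h : Hom X Y') (k : Hom Y' Z) (w : Hom Z W) :
  f · g = h · k -> f · (g · w) = h · (k · w).
Proof. intros E. rewrite <- !comp_assoc, E. reflexivity. Qed.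

Lemma ker_mono (X Y W : C) (f : Hom X Y) (u v : Hom W (Ker f)) :
  u · ker f = v · ker f -> u = v.
Proof. intros E. apply PB_unique; [exact E | apply to_zero_eq]. Qed.

Definition IsIso (X Y : C) (f : Hom X Y) : Prop :=
  exists g : Hom Y X, f · g = idm X /\ g · f = idm Y.

(** Yoneda: [Hom W f] bijective for all [W] makes [f] invertible.  It spares the
    explicit construction of inverses through two universal properties. *)
Lemma iso_of_generalized_elements (X Y : C) (f : Hom X Y) :
  (forall (W : C) (u v : Hom W X), u · f = v · f -> u = v) ->
  (forall (W : C) (y : Hom W Y), exists x : Hom W X, x · f = y) ->
  IsIso f.
Proof.
  intros inj surj. destruct (surj Y (idm Y)) as [g gf]. exists g.
  split; [| exact gf].
  apply inj. rewrite comp_assoc, gf, comp_id_l, comp_id_r. reflexivity.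
Qed.

Lemma iso_sym (X Y : C) (f : Hom X Y) :
  IsIso f -> exists g : Hom Y X, IsIso g /\ f · g = idm X /\ g · f = idm Y.
Proof.
  intros [g [fg gf]]. exists g. split; [exists f |]; split; assumption.
Qed.

Lemma iso_square_sym (X Y X' Y' : C) (f : Hom X Y) (g : Hom X' Y')
  (p : Hom X X') (q : Hom Y Y') :
  IsIso p -> IsIso q -> p · g = f · q ->
  exists (p' : Hom X' X) (q' : Hom Y' Y),
    IsIso p' /\ IsIso q' /\ p' · f = g · q'.
Proof.
  intros isop isoq E.
  destruct (iso_sym isop) as [p' [isop' [pp' p'p]]].
  destruct (iso_sym isoq) as [q' [isoq' [qq' q'q]]].
  exists p', q'. split; [assumption | split; [assumption |]].
  transitivity (p' · (f · q) · q').
  - rewrite !comp_assoc, qq', comp_id_r. reflexivity.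
  - rewrite <- E, <- (comp_assoc p'), p'p, comp_id_l. reflexivity.
Qed.

Lemma regular_epi_along_iso (X Y X' Y' : C) (f : Hom X Y) (g : Hom X' Y')
  (p : Hom X X') (q : Hom Y Y') :
  IsIso p -> IsIso q -> p · g = f · q -> RegularEpi f -> RegularEpi g.
Proof.
  intros [p' [pp' p'p]] [q' [qq' q'q]] E [W [u [v [uv univ]]]].
  exists W, (u · p), (v · p). split.
  - rewrite !comp_assoc, E, <- !comp_assoc, uv. reflexivity.
  - intros Z h Eh. rewrite !comp_assoc in Eh.
    destruct (univ Z (p · h) Eh) as [t [ft t_unique]].
    exists (q' · t). split.
    + transitivity (p' · (p · g) · q' · t).
      * rewrite <- (comp_assoc p'), p'p, comp_id_l, comp_assoc. reflexivity.
      * rewrite E, !comp_assoc, <- (comp_assoc q), qq', comp_id_l, ft,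
          <- comp_assoc, p'p, comp_id_l. reflexivity.
    + intros t' gt'. rewrite (t_unique (q · t')).
      * rewrite <- comp_assoc, q'q, comp_id_l. reflexivity.
      * rewrite <- comp_assoc, <- E, comp_assoc, gt'. reflexivity.
Qed.

Lemma split_epi_along_iso (X Y X' Y' : C) (f : Hom X Y) (g : Hom X' Y')
  (p : Hom X X') (q : Hom Y Y') :
  IsIso q -> p · g = f · q -> SplitEpi f -> SplitEpi g.
Proof.
  intros [q' [qq' q'q]] E [s sf]. exists (q' · s · p).
  rewrite !comp_assoc, E, <- (comp_assoc s), sf, comp_id_l. exact q'q.
Qed.

End IsomorphicArrows.

(** * Calculus of generalized arrows in an internal groupoid *)

Section Composites.
Variables (C : PointedLexCategory) (B : Groupoid C).

(** Composition as a relation: unlike [gcomp], it carries no proof of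
    composability, so equal arrows can be rewritten freely inside it. *)
Definition Composite (X : C) (f g h : Hom X (ob1 B)) : Prop :=
  exists fg : f · cod B = g · dom B, gcomp fg = h.

Definition CommSquare (X : C) (f g f' g' : Hom X (ob1 B)) : Prop :=
  exists h, Composite f g h /\ Composite f' g' h.

Lemma pair_irrelevant (X Y Z W : C) (f : Hom X Z) (g : Hom Y Z)
  (x : Hom W X) (y : Hom W Y) (H H' : x · f = y · g) : pair H = pair H'.
Proof. apply PB_unique; rewrite ?pair_pr1, ?pair_pr2; reflexivity. Qed.

Lemma composite_exists (X : C) (f g : Hom X (ob1 B)) :
  f · cod B = g · dom B -> exists h, Composite f g h.
Proof. intros fg. exists (gcomp fg), fg. reflexivity. Qed.

Lemma composite_unique (X : C) (f g h h' : Hom X (ob1 B)) :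
  Composite f g h -> Composite f g h' -> h = h'.
Proof.
  intros [H E] [H' E']. rewrite <- E, <- E'. unfold gcomp. f_equal.
  apply pair_irrelevant.
Qed.

Lemma composite_composable (X : C) (f g h : Hom X (ob1 B)) :
  Composite f g h -> f · cod B = g · dom B.
Proof. intros [H _]. exact H. Qed.

Lemma composite_dom (X : C) (f g h : Hom X (ob1 B)) :
  Composite f g h -> h · dom B = f · dom B.
Proof.
  intros [H E]. rewrite <- E. unfold gcomp.
  rewrite comp_assoc, mul_dom, <- comp_assoc, pair_pr1. reflexivity.
Qed.

Lemma composite_cod (X : C) (f g h : Hom X (ob1 B)) :
  Composite f g h -> h · cod B = g · cod B.
Proof.
  intros [H E]. rewrite <- E. unfold gcomp.
  rewrite comp_assoc, mul_cod, <- comp_assoc, pair_pr2. reflexivity.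
Qed.

Lemma comm_square_gcomp (X : C) (f g f' g' : Hom X (ob1 B))
  (fg : f · cod B = g · dom B) (fg' : f' · cod B = g' · dom B) :
  CommSquare f g f' g' <-> gcomp fg = gcomp fg'.
Proof.
  split.
  - intros [h [H H']].
    rewrite (composite_unique (ex_intro _ fg eq_refl : Composite _ _ _) H).
    exact (composite_unique H' (ex_intro _ fg' eq_refl)).
  - intros E. exists (gcomp fg). split; [exists fg | exists fg']; auto.
Qed.

Lemma composite_precomp (X Y : C) (w : Hom X Y) (f g h : Hom Y (ob1 B)) :
  Composite f g h -> Composite (w · f) (w · g) (w · h).
Proof.
  intros [H E].
  assert (H' : (w · f) · cod B = (w · g) · dom B)
    by (rewrite !comp_assoc, H; reflexivity).
  exists H'. rewrite <- E. unfold gcomp. rewrite <- comp_assoc. f_equal.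
  apply PB_unique; rewrite comp_assoc, ?pair_pr1, ?pair_pr2; reflexivity.
Qed.

Lemma composite_mul :
  Composite (pr1 (cod B) (dom B)) (pr2 (cod B) (dom B)) (mul B).
Proof.
  exists (pr_square _ _). unfold gcomp.
  transitivity (idm _ · mul B); [| apply comp_id_l]. f_equal.
  apply PB_unique; rewrite ?pair_pr1, ?pair_pr2, comp_id_l; reflexivity.
Qed.

Lemma composite_assoc (X : C) (f g h fg gh k : Hom X (ob1 B)) :
  Composite f g fg -> Composite g h gh ->
  (Composite fg h k <-> Composite f gh k).
Proof.
  intros [H E] [H' E']. subst fg gh.
  pose proof (mul_assoc H H') as A. split; intros [P Q].
  - exists (composable_mul_r (mul_dom B) H H').
    etransitivity; [symmetry; exact A |]. rewrite <- Q.
    unfold gcomp. f_equal. apply pair_irrelevant.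
  - exists (composable_mul_l (mul_cod B) H H').
    etransitivity; [exact A |]. rewrite <- Q.
    unfold gcomp. f_equal. apply pair_irrelevant.
Qed.

Lemma composite_unit_l (X : C) (x : Hom X (ob0 B)) (f : Hom X (ob1 B)) :
  f · dom B = x -> Composite (x · unt B) f f.
Proof.
  intros <-. rewrite comp_assoc.
  pose proof (composite_precomp f (ex_intro _ _ (mul_unt_l B))) as H.
  rewrite !comp_id_r in H. exact H.
Qed.

Lemma composite_unit_r (X : C) (x : Hom X (ob0 B)) (f : Hom X (ob1 B)) :
  f · cod B = x -> Composite f (x · unt B) f.
Proof.
  intros <-. rewrite comp_assoc.
  pose proof (composite_precomp f (ex_intro _ _ (mul_unt_r B))) as H.
  rewrite !comp_id_r in H. exact H.
Qed.

Lemma composite_inv_l (X : C) (f : Hom X (ob1 B)) :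
  Composite (f · inv B) f (f · cod B · unt B).
Proof.
  pose proof (composite_precomp f (ex_intro _ _ (mul_inv_l B))) as H.
  rewrite comp_id_r, <- comp_assoc in H. exact H.
Qed.

Lemma composite_inv_r (X : C) (f : Hom X (ob1 B)) :
  Composite f (f · inv B) (f · dom B · unt B).
Proof.
  pose proof (composite_precomp f (ex_intro _ _ (mul_inv_r B))) as H.
  rewrite comp_id_r, <- comp_assoc in H. exact H.
Qed.

Lemma composite_div_r (X : C) (f g h : Hom X (ob1 B)) :
  Composite f g h -> Composite h (g · inv B) f.
Proof.
  intros H. apply (composite_assoc _ H (composite_inv_r g)).
  apply composite_unit_r. exact (composite_composable H).
Qed.

Lemma composite_div_l (X : C) (f g h : Hom X (ob1 B)) :
  Composite f g h -> Composite (f · inv B) h g.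
Proof.
  intros H. apply (composite_assoc _ (composite_inv_l f) H).
  apply composite_unit_l. symmetry. exact (composite_composable H).
Qed.

Lemma composite_cancel_r (X : C) (f f' g h : Hom X (ob1 B)) :
  Composite f g h -> Composite f' g h -> f = f'.
Proof.
  intros H H'. exact (composite_unique (composite_div_r H) (composite_div_r H')).
Qed.

(** Inverses are determined by composition; this is what lets functors be built
    without checking compatibility with [inv] separately. *)
Lemma inv_of_composite (X : C) (f g : Hom X (ob1 B)) :
  Composite g f (f · cod B · unt B) -> g = f · inv B.
Proof. intros H. exact (composite_cancel_r H (composite_inv_l f)). Qed.

Lemma inv_inv : inv B · inv B = idm (ob1 B).
Proof.
  symmetry. apply inv_of_composite. rewrite inv_cod.
  pose proof (composite_inv_r (idm (ob1 B))) as H.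
  rewrite !comp_id_l in H. exact H.
Qed.

Lemma inv_mono (X : C) (f g : Hom X (ob1 B)) :
  f · inv B = g · inv B -> f = g.
Proof.
  intros E. rewrite <- (comp_id_r f), <- (comp_id_r g), <- inv_inv.
  rewrite <- !comp_assoc, E. reflexivity.
Qed.

End Composites.

(** * Functors and transformations on generalized arrows *)

Section FunctorsOnComposites.
Variables (C : PointedLexCategory) (A B : Groupoid C).

Lemma functor_composite (F : Functor A B) (X : C) (f g h : Hom X (ob1 A)) :
  Composite f g h -> Composite (f · fun1 F) (g · fun1 F) (h · fun1 F).
Proof.
  intros [H E]. subst h. unfold gcomp. rewrite comp_assoc, fun_mul.
  pose proof (composite_precomp (pair H)
    (ex_intro _ (composable_functor (fun_dom F) (fun_cod F)) eq_refl
      : Composite _ _ _)) as K.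
  rewrite <- !comp_assoc, pair_pr1, pair_pr2 in K. exact K.
Qed.

(** Compatibility with inverses is derived, because inverses are unique. *)
Definition functor_of_composites
    (F0 : Hom (ob0 A) (ob0 B)) (F1 : Hom (ob1 A) (ob1 B))
    (Fd : F1 · dom B = dom A · F0) (Fc : F1 · cod B = cod A · F0)
    (Fu : unt A · F1 = F0 · unt B)
    (Fm : forall (X : C) (f g h : Hom X (ob1 A)),
      Composite f g h -> Composite (f · F1) (g · F1) (h · F1)) :
  Functor A B.
Proof.
  refine {| fun0 := F0; fun1 := F1; fun_dom := Fd; fun_cod := Fc;
            fun_unt := Fu |}.
  - exact (composite_unique (Fm _ _ _ _ (composite_mul A))
      (ex_intro _ _ eq_refl)).
  - apply inv_of_composite.
    pose proof (Fm _ _ _ _ (composite_inv_l (idm (ob1 A)))) as H.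
    rewrite !comp_id_l, comp_assoc, Fu, <- comp_assoc, <- Fc in H. exact H.
Defined.

(** Naturality at a generalized arrow [f], not just at the universal one. *)
Lemma natural_square (F G : Functor A B) (a : NatTrans F G)
  (X : C) (f : Hom X (ob1 A)) :
  CommSquare (f · (dom A · a)) (f · fun1 G) (f · fun1 F) (f · (cod A · a)).
Proof.
  pose proof (proj2 (comm_square_gcomp _ _) (nt_natural a)) as [h [H H']].
  exists (f · h). split; apply composite_precomp; assumption.
Qed.

Definition nat_of_square (F G : Functor A B) (a : Hom (ob0 A) (ob1 B))
    (ad : a · dom B = fun0 F) (ac : a · cod B = fun0 G)
    (nat : CommSquare (dom A · a) (fun1 G) (fun1 F) (cod A · a)) :
    NatTrans F G :=
  {| nt_arr := a; nt_dom := ad; nt_cod := ac;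
     nt_natural := proj1 (comm_square_gcomp _ _) nat |}.

End FunctorsOnComposites.

(** * Discrete groupoids *)

Section Discrete.
Variables (C : PointedLexCategory) (X : C).

Definition discrete : Groupoid C.
Proof.
  unshelve refine {| ob0 := X; ob1 := X; dom := idm X; cod := idm X;
    unt := idm X; mul := pr1 (idm X) (idm X); inv := idm X |};
  intros; rewrite ?pair_pr1, ?comp_id_l; try reflexivity.
  exact (pr_square (idm X) (idm X)).
Defined.

Lemma composite_discrete (W : C) (f g h : Hom W (ob1 discrete)) :
  Composite f g h -> f = h /\ g = h.
Proof.
  intros H. pose proof (composite_dom H) as D. pose proof (composite_cod H) as E.
  simpl in D, E. rewrite !comp_id_r in D, E. split; symmetry; assumption.
Qed.

Definition point (B : Groupoid C) (x : Hom X (ob0 B)) : Functor discrete B.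
Proof.
  unshelve refine (@functor_of_composites _ discrete B x (x · unt B) _ _ _ _).
  - simpl. rewrite comp_assoc, unt_dom, comp_id_l, comp_id_r. reflexivity.
  - simpl. rewrite comp_assoc, unt_cod, comp_id_l, comp_id_r. reflexivity.
  - apply comp_id_l.
  - intros W f g h H. destruct (composite_discrete H) as [-> ->].
    rewrite <- comp_assoc. apply composite_unit_l.
    rewrite !comp_assoc, unt_dom, comp_id_r. reflexivity.
Defined.

(** Together with [point]: functors from the discrete groupoid on [X] are the
    generalized elements [X -> B0], since every arrow is an identity. *)
Lemma discrete_functor_fun1 (B : Groupoid C) (G : Functor discrete B) :
  fun1 G = fun0 G · unt B.
Proof. rewrite <- fun_unt. symmetry. apply comp_id_l. Qed.

Lemma discrete_functor_eq (B : Groupoid C) (G H : Functor discrete B) :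
  fun0 G = fun0 H -> eq_functor G H.
Proof.
  intros E. split; [exact E |]. rewrite !discrete_functor_fun1, E. reflexivity.
Qed.

(** Naturality is automatic over a discrete groupoid, so generalized arrows
    [X -> B1] are 2-cells. *)
Definition discrete_nat (B : Groupoid C) (G H : Functor discrete B)
    (a : Hom X (ob1 B)) (ad : a · dom B = fun0 G) (ac : a · cod B = fun0 H) :
    NatTrans G H.
Proof.
  refine (@nat_of_square _ discrete B G H a ad ac _).
  exists a. rewrite !discrete_functor_fun1. simpl. rewrite !comp_id_l. split.
  - apply composite_unit_r. exact ac.
  - apply composite_unit_l. exact ad.
Defined.

End Discrete.

(** * The kernel of a functor *)

Section KernelGroupoid.
Variables (C : PointedLexCategory) (A B : Groupoid C) (F : Functor A B).

Lemma composite_zero (D : Groupoid C) (X : C) :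
  Composite (zero X (ob1 D)) (zero X (ob1 D)) (zero X (ob1 D)).
Proof.
  pose proof (composite_unit_l (zero_l X (dom D))) as H.
  rewrite zero_l in H. exact H.
Qed.

Lemma ker_dom_zero : (ker (fun1 F) · dom A) · fun0 F = zero _ _.
Proof. rewrite comp_assoc, <- fun_dom, <- comp_assoc, ker_zero. apply zero_l. Qed.
Lemma ker_cod_zero : (ker (fun1 F) · cod A) · fun0 F = zero _ _.
Proof. rewrite comp_assoc, <- fun_cod, <- comp_assoc, ker_zero. apply zero_l. Qed.
Lemma ker_unt_zero : (ker (fun0 F) · unt A) · fun1 F = zero _ _.
Proof. rewrite comp_assoc, fun_unt, <- comp_assoc, ker_zero. apply zero_l. Qed.
Lemma ker_inv_zero : (ker (fun1 F) · inv A) · fun1 F = zero _ _.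
Proof. rewrite comp_assoc, fun_inv, <- comp_assoc, ker_zero. apply zero_l. Qed.

(** [kdom], [kcod], [kunt], [kinv] and [kmul] restrict the structure of [A] to the
    kernels of [fun0 F] and [fun1 F].  The kernel inclusions being monic, each
    groupoid axiom is inherited from [A]. *)
Definition kdom : Hom (Ker (fun1 F)) (Ker (fun0 F)) := ker_lift ker_dom_zero.
Definition kcod : Hom (Ker (fun1 F)) (Ker (fun0 F)) := ker_lift ker_cod_zero.
Definition kunt : Hom (Ker (fun0 F)) (Ker (fun1 F)) := ker_lift ker_unt_zero.
Definition kinv : Hom (Ker (fun1 F)) (Ker (fun1 F)) := ker_lift ker_inv_zero.

Lemma kdom_ker : kdom · ker (fun0 F) = ker (fun1 F) · dom A.
Proof. apply ker_lift_ker. Qed.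
Lemma kcod_ker : kcod · ker (fun0 F) = ker (fun1 F) · cod A.
Proof. apply ker_lift_ker. Qed.
Lemma kunt_ker : kunt · ker (fun1 F) = ker (fun0 F) · unt A.
Proof. apply ker_lift_ker. Qed.
Lemma kinv_ker : kinv · ker (fun1 F) = ker (fun1 F) · inv A.
Proof. apply ker_lift_ker. Qed.

Lemma kmul_composable :
  (pr1 kcod kdom · ker (fun1 F)) · cod A = (pr2 kcod kdom · ker (fun1 F)) · dom A.
Proof.
  rewrite !comp_assoc, <- kdom_ker, <- kcod_ker, <- !comp_assoc, pr_square.
  reflexivity.
Qed.

Lemma ker_composite_zero (X : C) (f g : Hom X (Ker (fun1 F))) (h : Hom X (ob1 A)) :
  Composite (f · ker (fun1 F)) (g · ker (fun1 F)) h -> h · fun1 F = zero _ _.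
Proof.
  intros H. pose proof (functor_composite F H) as K.
  rewrite !comp_assoc, ker_zero, !zero_r in K.
  exact (composite_unique K (composite_zero _ _)).
Qed.

Definition kmul : Hom (PB kcod kdom) (Ker (fun1 F)) :=
  ker_lift (ker_composite_zero (ex_intro _ kmul_composable eq_refl)).

Lemma kmul_composite (X : C) (f g : Hom X (Ker (fun1 F)))
  (fg : f · kcod = g · kdom) :
  Composite (f · ker (fun1 F)) (g · ker (fun1 F)) ((pair fg · kmul) · ker (fun1 F)).
Proof.
  pose proof (composite_precomp (pair fg)
    (ex_intro _ kmul_composable eq_refl : Composite _ _ _)) as H.
  rewrite <- !comp_assoc, pair_pr1, pair_pr2 in H.
  rewrite comp_assoc. unfold kmul. rewrite ker_lift_ker. exact H.
Qed.

Definition kernel_groupoid : Groupoid C.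
Proof.
  unshelve refine {| ob0 := Ker (fun0 F); ob1 := Ker (fun1 F);
    dom := kdom; cod := kcod; unt := kunt; mul := kmul; inv := kinv |}.
  - apply ker_mono.
    rewrite comp_assoc, kdom_ker, (square_assoc _ kunt_ker), unt_dom,
      comp_id_l, comp_id_r. reflexivity.
  - apply ker_mono.
    rewrite comp_assoc, kcod_ker, (square_assoc _ kunt_ker), unt_cod,
      comp_id_l, comp_id_r. reflexivity.
  - apply ker_mono. rewrite !comp_assoc, kdom_ker, <- comp_assoc.
    unfold kmul. rewrite ker_lift_ker.
    rewrite (composite_dom (ex_intro _ kmul_composable eq_refl)).
    apply comp_assoc.
  - apply ker_mono. rewrite !comp_assoc, kcod_ker, <- comp_assoc.
    unfold kmul. rewrite ker_lift_ker.
    rewrite (composite_cod (ex_intro _ kmul_composable eq_refl)).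
    apply comp_assoc.
  - apply ker_mono.
    rewrite comp_assoc, kdom_ker, (square_assoc _ kinv_ker), inv_dom, kcod_ker.
    reflexivity.
  - apply ker_mono.
    rewrite comp_assoc, kcod_ker, (square_assoc _ kinv_ker), inv_cod, kdom_ker.
    reflexivity.
  - intros X f g h fg gh. apply ker_mono.
    refine (composite_unique _ (kmul_composite _)).
    apply (composite_assoc _ (kmul_composite fg) (kmul_composite gh)).
    apply kmul_composite.
  - apply ker_mono.
    refine (composite_unique (kmul_composite _) _).
    rewrite (comp_assoc kdom), kunt_ker, <- (comp_assoc kdom), comp_id_l.
    apply composite_unit_l. symmetry. exact kdom_ker.
  - apply ker_mono.
    refine (composite_unique (kmul_composite _) _).
    rewrite (comp_assoc kcod), kunt_ker, <- (comp_assoc kcod), comp_id_l.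
    apply composite_unit_r. symmetry. exact kcod_ker.
  - apply ker_mono.
    refine (composite_unique (kmul_composite _) _).
    rewrite (comp_assoc kcod), kunt_ker, <- (comp_assoc kcod), kcod_ker,
      kinv_ker, comp_id_l. apply composite_inv_l.
  - apply ker_mono.
    refine (composite_unique (kmul_composite _) _).
    rewrite (comp_assoc kdom), kunt_ker, <- (comp_assoc kdom), kdom_ker,
      kinv_ker, comp_id_l. apply composite_inv_r.
Defined.

Definition kernel_inclusion : Functor kernel_groupoid A.
Proof.
  unshelve refine (@functor_of_composites _ kernel_groupoid A
    (ker (fun0 F)) (ker (fun1 F)) _ _ _ _).
  - symmetry. exact kdom_ker.
  - symmetry. exact kcod_ker.
  - exact kunt_ker.
  - intros X f g h [fg <-]. apply kmul_composite.
Defined.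

Lemma kernel_inclusion_zero :
  eq_functor (comp_functor kernel_inclusion F) (zero_functor kernel_groupoid B).
Proof. split; apply ker_zero. Qed.

Section UniversalKernel.
Variables (N : Groupoid C) (K : Functor N A) (kerK : IsKernelFunctor F K).

Lemma kernel_ob_zero : fun0 K · fun0 F = zero _ _.
Proof. exact (proj1 (proj1 kerK)). Qed.

Lemma kernel_arrow_zero : fun1 K · fun1 F = zero _ _.
Proof. exact (proj2 (proj1 kerK)). Qed.

(** The kernel property tested on the functor [a] out of the discrete groupoid. *)
Lemma kernel_ob_lift (X : C) (a : Hom X (ob0 A)) :
  a · fun0 F = zero _ _ -> exists x : Hom X (ob0 N), x · fun0 K = a.
Proof.
  intros Ha.
  destruct (proj2 kerK (discrete X) (point a)) as [T [[HT _] _]].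
  - apply discrete_functor_eq. exact Ha.
  - exists (fun0 T). exact HT.
Qed.

Lemma kernel_ob_mono (X : C) (x y : Hom X (ob0 N)) :
  x · fun0 K = y · fun0 K -> x = y.
Proof.
  intros E.
  destruct (proj2 kerK (discrete X) (point (x · fun0 K))) as [T [_ uniq]].
  - apply discrete_functor_eq. simpl.
    rewrite comp_assoc, kernel_ob_zero. apply zero_r.
  - destruct (uniq (point x)) as [Ex _]; [apply discrete_functor_eq; reflexivity |].
    destruct (uniq (point y)) as [Ey _];
      [apply discrete_functor_eq; symmetry; exact E |].
    exact (eq_trans Ex (eq_sym Ey)).
Qed.

(** [K] factored through the level-wise kernel. *)
Definition kernel_corestriction : Functor N kernel_groupoid.
Proof.
  unshelve refine (@functor_of_composites _ N kernel_groupoid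
    (ker_lift kernel_ob_zero) (ker_lift kernel_arrow_zero) _ _ _ _); simpl.
  - apply ker_mono.
    rewrite !comp_assoc, kdom_ker, ker_lift_ker, <- comp_assoc, ker_lift_ker.
    apply fun_dom.
  - apply ker_mono.
    rewrite !comp_assoc, kcod_ker, ker_lift_ker, <- comp_assoc, ker_lift_ker.
    apply fun_cod.
  - apply ker_mono.
    rewrite !comp_assoc, kunt_ker, ker_lift_ker, <- comp_assoc, ker_lift_ker.
    apply fun_unt.
  - intros X f g h H. pose proof (functor_composite K H) as HK.
    assert (fg : (f · ker_lift kernel_arrow_zero) · kcod
                 = (g · ker_lift kernel_arrow_zero) · kdom).
    { apply ker_mono.
      rewrite !comp_assoc, kcod_ker, kdom_ker, <- !(comp_assoc (ker_lift _)),
        ker_lift_ker, <- !comp_assoc.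
      exact (composite_composable HK). }
    exists fg. apply ker_mono.
    pose proof (kmul_composite fg) as L.
    rewrite !(comp_assoc f), !(comp_assoc g), ker_lift_ker in L.
    rewrite comp_assoc, ker_lift_ker. exact (composite_unique L HK).
Defined.

(** The level-wise kernel factors through [N] and conversely; the round trip on
    [N] is the identity, since it and the identity both factor [K] through [K].
    Hence generalized arrows of [N] are those of [A] killed by [F]. *)
Lemma kernel_arrow_retraction :
  exists t : Hom (Ker (fun1 F)) (ob1 N),
    t · fun1 K = ker (fun1 F) /\ ker_lift kernel_arrow_zero · t = idm (ob1 N).
Proof.
  destruct (proj2 kerK kernel_groupoid kernel_inclusion kernel_inclusion_zero)
    as [T [TK _]].
  exists (fun1 T). split; [exact (proj2 TK) |].
  destruct (proj2 kerK N K (proj1 kerK)) as [I [_ uniq]].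
  destruct (uniq (comp_functor kernel_corestriction T)) as [_ E].
  { split; simpl; rewrite comp_assoc.
    - etransitivity; [exact (f_equal _ (proj1 TK)) | apply ker_lift_ker].
    - etransitivity; [exact (f_equal _ (proj2 TK)) | apply ker_lift_ker]. }
  destruct (uniq (id_functor N)) as [_ E'].
  { split; apply comp_id_l. }
  exact (eq_trans E (eq_sym E')).
Qed.

Lemma kernel_arrow_mono (X : C) (u v : Hom X (ob1 N)) :
  u · fun1 K = v · fun1 K -> u = v.
Proof.
  intros E. destruct kernel_arrow_retraction as [t [_ st]].
  rewrite <- (comp_id_r u), <- (comp_id_r v), <- st, <- !comp_assoc. f_equal.
  apply ker_mono. rewrite !comp_assoc, ker_lift_ker. exact E.
Qed.

Lemma kernel_arrow_lift (X : C) (a : Hom X (ob1 A)) :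
  a · fun1 F = zero _ _ -> exists u : Hom X (ob1 N), u · fun1 K = a.
Proof.
  intros E. destruct kernel_arrow_retraction as [t [tK _]].
  exists (ker_lift E · t). rewrite comp_assoc, tK. apply ker_lift_ker.
Qed.

End UniversalKernel.
End KernelGroupoid.

(** * The strong h-kernel of a functor *)

Section StrongHKernel.
Variables (C : PointedLexCategory) (A B P : Groupoid C) (F : Functor A B).
Variables (K : Functor P A) (k : NatTrans (zero_functor P B) (comp_functor K F)).
Hypothesis hker : IsStrongHKernel k.

Lemma hkernel_dom : k · dom B = zero _ _.
Proof. exact (nt_dom k). Qed.

Lemma hkernel_cod : k · cod B = fun0 K · fun0 F.
Proof. exact (nt_cod k). Qed.

(** The 1-dimensional property of the h-kernel tested on a discrete groupoid. *)
Lemma hkernel_ob_lift (X : C) (a : Hom X (ob0 A)) (b : Hom X (ob1 B)) :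
  b · dom B = zero _ _ -> b · cod B = a · fun0 F ->
  exists p : Hom X (ob0 P), p · fun0 K = a /\ p · k = b.
Proof.
  intros bd bc.
  pose (mu := @discrete_nat _ X B
    (comp_functor (to_zero_functor _) (from_zero_functor B))
    (comp_functor (point a) F) b bd bc).
  destruct (proj1 hker (discrete X) (point a) (to_zero_functor _) mu)
    as [T [[[Ta _] [_ Tb]] _]].
  exists (fun0 T). split; assumption.
Qed.

Lemma hkernel_ob_mono (X : C) (p q : Hom X (ob0 P)) :
  p · fun0 K = q · fun0 K -> p · k = q · k -> p = q.
Proof.
  intros Ea Eb.
  assert (bd : (p · k) · dom B = zero _ _)
    by (rewrite comp_assoc, hkernel_dom; apply zero_r).
  assert (bc : (p · k) · cod B = (p · fun0 K) · fun0 F)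
    by (rewrite !comp_assoc, hkernel_cod; reflexivity).
  pose (mu := @discrete_nat _ X B
    (comp_functor (to_zero_functor _) (from_zero_functor B))
    (comp_functor (point (p · fun0 K)) F) (p · k) bd bc).
  destruct (proj1 hker (discrete X) (point (p · fun0 K)) (to_zero_functor _) mu)
    as [T [_ uniq]].
  destruct (uniq (point p)) as [Ep _].
  { split; [apply discrete_functor_eq; reflexivity |].
    split; [split; apply to_zero_eq | reflexivity]. }
  destruct (uniq (point q)) as [Eq _].
  { split; [apply discrete_functor_eq; symmetry; exact Ea |].
    split; [split; apply to_zero_eq | symmetry; exact Eb]. }
  exact (eq_trans Ep (eq_sym Eq)).
Qed.

(** Naturality of [k] at [h]; the other side of the square collapses because the
    zero functor sends [h] to an identity. *)
Lemma hkernel_arrow_square (X : C) (h : Hom X (ob1 P)) :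
  Composite (h · dom P · k) (h · fun1 K · fun1 F) (h · cod P · k).
Proof.
  destruct (natural_square k h) as [m [H H']]. simpl in H.
  change (fun1 (zero_functor P B)) with (zero (ob1 P) (ob1 B)) in H'.
  rewrite zero_r in H'.
  assert (E : m = h · (cod P · k)).
  { refine (composite_unique H' _). rewrite <- (zero_l X (unt B)).
    apply composite_unit_l.
    rewrite !comp_assoc, hkernel_dom, !zero_r. reflexivity. }
  rewrite E in H. rewrite !comp_assoc. exact H.
Qed.

(** The 2-dimensional property of the h-kernel tested on a discrete groupoid,
    where generalized arrows are 2-cells between the points [p] and [q]. *)
Lemma hkernel_arrow_classified (X : C) (p q : Hom X (ob0 P)) (a : Hom X (ob1 A)) :
  a · dom A = p · fun0 K -> a · cod A = q · fun0 K ->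
  Composite (p · k) (a · fun1 F) (q · k) ->
  exists h : Hom X (ob1 P),
    (h · dom P = p /\ h · cod P = q /\ h · fun1 K = a) /\
    forall h' : Hom X (ob1 P),
      h' · dom P = p -> h' · cod P = q -> h' · fun1 K = a -> h' = h.
Proof.
  intros ad ac sq.
  pose (alpha := @discrete_nat _ X (zero_groupoid C)
    (comp_functor (point p) (to_zero_functor P))
    (comp_functor (point q) (to_zero_functor P))
    (to_zero X) (to_zero_eq _ _) (to_zero_eq _ _)).
  pose (beta := @discrete_nat _ X A (comp_functor (point p) K)
    (comp_functor (point q) K) a ad ac).
  destruct (proj2 hker (discrete X) (point p) (point q) alpha beta)
    as [h [[_ ha] uniq]].
  { apply comm_square_gcomp. exists (q · k). split; [exact sq |].
    change (Composite (zero X (ob1 B)) (q · k) (q · k)).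
    rewrite <- (zero_l X (unt B)). apply composite_unit_l.
    rewrite comp_assoc, hkernel_dom. apply zero_r. }
  exists h. split; [exact (conj (nt_dom h) (conj (nt_cod h) ha)) |].
  intros h' hd hc h'a.
  apply (uniq (@discrete_nat _ X P (point p) (point q) h' hd hc)).
  split; [apply to_zero_eq | exact h'a].
Qed.

Lemma hkernel_arrow_mono (X : C) (h h' : Hom X (ob1 P)) :
  h · dom P = h' · dom P -> h · cod P = h' · cod P ->
  h · fun1 K = h' · fun1 K -> h = h'.
Proof.
  intros Ed Ec Ea.
  destruct (@hkernel_arrow_classified X (h · dom P) (h · cod P) (h · fun1 K))
    as [h0 [_ uniq]].
  - rewrite !comp_assoc, fun_dom. reflexivity.
  - rewrite !comp_assoc, fun_cod. reflexivity.
  - apply hkernel_arrow_square.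
  - rewrite (uniq h); auto. symmetry. apply uniq; auto.
Qed.

End StrongHKernel.

(** * Equivalences among fully faithful functors *)

Section FullyFaithfulFunctors.
Variables (C : PointedLexCategory) (A B : Groupoid C) (F : Functor A B).

(** The counit of an equivalence gives, for each object [y] of [B], the object
    [G y] with an arrow [F (G y) -> y]: a section. *)
Lemma split_of_equivalence :
  Equivalence F -> SplitEpi (pr2 (fun0 F) (dom B) · cod B).
Proof.
  intros [G [_ [eps]]].
  assert (E : fun0 G · fun0 F = eps · dom B) by (symmetry; exact (nt_dom eps)).
  exists (pair E). rewrite <- comp_assoc, pair_pr2. exact (nt_cod eps).
Qed.

Hypothesis ff : FullyFaithful F.

Lemma fully_faithful_eq (X : C) (u v : Hom X (ob1 A)) :
  u · dom A = v · dom A -> u · cod A = v · cod A -> u · fun1 F = v · fun1 F ->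
  u = v.
Proof.
  intros Ed Ec EF.
  destruct (ff (x := v · dom A) (b := v · fun1 F) (y := v · cod A))
    as [w [_ uniq]].
  - rewrite !comp_assoc, fun_dom. reflexivity.
  - rewrite !comp_assoc, fun_cod. reflexivity.
  - rewrite <- (uniq u), <- (uniq v); auto.
Qed.

(** A section of the arrow testing essential surjectivity chooses an object
    [G0 y] of [A] and an arrow [eps y : F (G0 y) -> y] for each [y].  The action
    [G1] on arrows is the one for which [eps] becomes natural, and as [eps] can
    be cancelled, the functor laws for [G1] hold after applying [F], hence before. *)
Section QuasiInverse.
Variables (G0 : Hom (ob0 B) (ob0 A)) (eps : Hom (ob0 B) (ob1 B)).
Hypothesis eps_dom : eps · dom B = G0 · fun0 F.
Hypothesis eps_cod : eps · cod B = idm (ob0 B).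
Variable G1 : Hom (ob1 B) (ob1 A).
Hypothesis G1_dom : G1 · dom A = dom B · G0.
Hypothesis G1_cod : G1 · cod A = cod B · G0.
Hypothesis G1_square :
  CommSquare (dom B · eps) (idm (ob1 B)) (G1 · fun1 F) (cod B · eps).

Lemma quasi_inverse_square (X : C) (b : Hom X (ob1 B)) :
  CommSquare (b · dom B · eps) b (b · G1 · fun1 F) (b · cod B · eps).
Proof.
  destruct G1_square as [m [H H']]. exists (b · m).
  rewrite !comp_assoc. split; [| apply composite_precomp; assumption].
  pose proof (composite_precomp b H) as L. rewrite comp_id_r in L. exact L.
Qed.

Lemma quasi_inverse_unt : unt B · G1 = G0 · unt A.
Proof.
  apply fully_faithful_eq.
  - rewrite !comp_assoc, G1_dom, <- !comp_assoc, unt_dom, comp_assoc, unt_dom,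
      comp_id_l, comp_id_r. reflexivity.
  - rewrite !comp_assoc, G1_cod, <- !comp_assoc, unt_cod, comp_assoc, unt_cod,
      comp_id_l, comp_id_r. reflexivity.
  - destruct (quasi_inverse_square (unt B)) as [m [H H']].
    rewrite unt_dom, comp_id_l in H. rewrite unt_cod, comp_id_l in H'.
    assert (E : m = eps).
    { refine (composite_unique H _).
      pose proof (composite_unit_r eps_cod) as L.
      rewrite comp_id_l in L. exact L. }
    subst m.
    rewrite (comp_assoc G0), fun_unt, <- (comp_assoc G0).
    refine (composite_cancel_r H' _). apply composite_unit_l. exact eps_dom.
Qed.

(** Pasting the naturality squares of [f] and [g] gives that of [h]; cancelling
    [eps] compares the two candidates for the image under [F]. *)
Lemma quasi_inverse_mul (X : C) (f g h : Hom X (ob1 B)) :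
  Composite f g h -> Composite (f · G1) (g · G1) (h · G1).
Proof.
  intros H.
  destruct (@composite_exists _ A X (f · G1) (g · G1)) as [w W].
  { rewrite !comp_assoc, G1_dom, G1_cod, <- !comp_assoc, (composite_composable H).
    reflexivity. }
  enough (E : h · G1 = w) by (rewrite E; exact W).
  apply fully_faithful_eq.
  - rewrite (composite_dom W), !comp_assoc, G1_dom, <- !comp_assoc,
      (composite_dom H). reflexivity.
  - rewrite (composite_cod W), !comp_assoc, G1_cod, <- !comp_assoc,
      (composite_cod H). reflexivity.
  - pose proof (functor_composite F W) as FW.
    destruct (quasi_inverse_square f) as [m [Hf Hf']].
    destruct (quasi_inverse_square g) as [n [Hg Hg']].
    destruct (quasi_inverse_square h) as [q [Hh Hh']].
    refine (composite_cancel_r Hh' _).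
    rewrite (composite_cod H).
    apply (composite_assoc _ FW Hg').
    rewrite (composite_composable H) in Hf'.
    apply (composite_assoc _ Hf' Hg).
    apply (composite_assoc _ Hf H).
    rewrite <- (composite_dom H). exact Hh.
Qed.

Definition quasi_inverse : Functor B A :=
  functor_of_composites G1_dom G1_cod quasi_inverse_unt quasi_inverse_mul.

Lemma quasi_inverse_counit :
  inhabited (NatTrans (comp_functor quasi_inverse F) (id_functor B)).
Proof.
  constructor.
  exact (@nat_of_square _ B B (comp_functor quasi_inverse F) (id_functor B)
    eps eps_dom eps_cod G1_square).
Qed.

(** The unit at [x] is the arrow [x -> G (F x)] that [F] sends to the inverse of
    [eps (F x)]; its naturality, checked after [F], is the inverse of that of
    [eps]. *)
Lemma quasi_inverse_unit :
  inhabited (NatTrans (id_functor A) (comp_functor F quasi_inverse)).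
Proof.
  destruct (ff (x := idm (ob0 A)) (b := (fun0 F · eps) · inv B)
    (y := fun0 F · G0)) as [eta [[eta_dom [eta_F eta_cod]] _]].
  - rewrite comp_id_l, !comp_assoc, inv_dom, eps_cod, comp_id_r. reflexivity.
  - rewrite !comp_assoc, inv_cod, eps_dom. reflexivity.
  - constructor.
    refine (@nat_of_square _ A A (id_functor A) (comp_functor F quasi_inverse)
      eta eta_dom eta_cod _).
    simpl.
    destruct (@composite_exists _ A _ (dom A · eta) (fun1 F · G1)) as [u U].
    { rewrite !comp_assoc, eta_cod, G1_dom, <- !comp_assoc, fun_dom. reflexivity. }
    destruct (@composite_exists _ A _ (idm (ob1 A)) (cod A · eta)) as [v V].
    { rewrite comp_assoc, eta_dom, comp_id_l, comp_id_r. reflexivity. }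
    enough (E : u = v) by (exists u; split; [| rewrite E]; assumption).
    apply fully_faithful_eq.
    + rewrite (composite_dom U), (composite_dom V), comp_assoc, eta_dom,
        comp_id_l, comp_id_r. reflexivity.
    + rewrite (composite_cod U), (composite_cod V), !comp_assoc, eta_cod, G1_cod,
        <- !comp_assoc, fun_cod. reflexivity.
    + rewrite comp_assoc in eta_F.
      pose proof (functor_composite F U) as FU.
      pose proof (functor_composite F V) as FV.
      rewrite !comp_assoc, eta_F in FU.
      rewrite comp_assoc, eta_F, comp_id_l in FV.
      destruct (quasi_inverse_square (fun1 F)) as [m [H H']].
      rewrite fun_dom in H. rewrite fun_cod in H'.
      rewrite !comp_assoc in H, H'.
      apply composite_div_r in H'.
      rewrite !comp_assoc in H'.
      apply (composite_assoc _ H FV), composite_div_l in H'.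
      rewrite !comp_assoc in H'.
      exact (composite_unique FU H').
Qed.

End QuasiInverse.

(** [F] sends [G1 b] to the conjugate [eps · b · eps^-1], read off the naturality
    square that [eps] has to satisfy. *)
Lemma equivalence_of_split :
  SplitEpi (pr2 (fun0 F) (dom B) · cod B) -> Equivalence F.
Proof.
  intros [s Hs].
  set (G0 := s · pr1 (fun0 F) (dom B)).
  set (eps := s · pr2 (fun0 F) (dom B)).
  assert (eps_dom : eps · dom B = G0 · fun0 F)
    by (unfold eps, G0; rewrite !comp_assoc, pr_square; reflexivity).
  assert (eps_cod : eps · cod B = idm (ob0 B))
    by (unfold eps; rewrite comp_assoc; exact Hs).
  destruct (@composite_exists _ B _ (dom B · eps) (idm (ob1 B))) as [m Hm].
  { rewrite comp_assoc, eps_cod, comp_id_l, comp_id_r. reflexivity. }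
  destruct (@composite_exists _ B _ m ((cod B · eps) · inv B)) as [b Hb].
  { rewrite (composite_cod Hm), !comp_assoc, inv_dom, eps_cod, comp_id_l,
      comp_id_r. reflexivity. }
  destruct (ff (x := dom B · G0) (b := b) (y := cod B · G0))
    as [G1 [[G1_dom [G1_F G1_cod]] _]].
  { rewrite (composite_dom Hb), (composite_dom Hm), !comp_assoc, eps_dom.
    reflexivity. }
  { rewrite (composite_cod Hb), !comp_assoc, inv_cod, eps_dom. reflexivity. }
  assert (sq : CommSquare (dom B · eps) (idm (ob1 B)) (G1 · fun1 F) (cod B · eps)).
  { exists m. split; [exact Hm |]. rewrite G1_F.
    pose proof (composite_div_r Hb) as H.
    rewrite (comp_assoc (cod B · eps)), inv_inv, comp_id_r in H. exact H. }
  exists (quasi_inverse eps_dom eps_cod G1_dom G1_cod sq).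
  split; [apply quasi_inverse_unit | apply quasi_inverse_counit].
Qed.

End FullyFaithfulFunctors.

(** * The comparison from the kernel to the strong h-kernel *)

Section Comparison.
Variables (C : PointedLexCategory) (A B : Groupoid C) (F : Functor A B).
Variables (N : Groupoid C) (K : Functor N A) (kerK : IsKernelFunctor F K).
Variables (P : Groupoid C) (L : Functor P A).
Variable l : NatTrans (zero_functor P B) (comp_functor L F).
Hypothesis hker : IsStrongHKernel l.
Variable J : Functor N P.
Hypothesis J_L : eq_functor (comp_functor J L) K.
Hypothesis J_l : fun0 J · l = zero _ _.

Lemma comparison_ob : fun0 J · fun0 L = fun0 K.
Proof. exact (proj1 J_L). Qed.

Lemma comparison_arrow : fun1 J · fun1 L = fun1 K.
Proof. exact (proj2 J_L). Qed.

(** Call [p · l : 0 -> F (L p)] the path at [p].  On an arrow [h] of the h-kernel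
    out of [J x] the path at the source is an identity, so [F (L h)] is the path at
    the target. *)
Lemma arrow_from_kernel (X : C) (x : Hom X (ob0 N)) (h : Hom X (ob1 P)) :
  h · dom P = x · fun0 J -> h · fun1 L · fun1 F = h · cod P · l.
Proof.
  intros hd. pose proof (hkernel_arrow_square l h) as H.
  rewrite hd, (comp_assoc x), J_l, zero_r in H.
  refine (composite_unique _ H). rewrite <- (zero_l X (unt B)).
  apply composite_unit_l. rewrite <- (composite_composable H). apply zero_l.
Qed.

(** An arrow [h] between [J x] and [J y] has [F (L h)] equal to the path at [J y],
    which is trivial, so [L h] comes from the kernel. *)
Lemma comparison_fully_faithful : FullyFaithful J.
Proof.
  intros X x h y hd hc.
  destruct (@kernel_arrow_lift _ _ _ _ _ _ kerK X (h · fun1 L)) as [u uK].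
  { rewrite (arrow_from_kernel (eq_sym hd)), hc, (comp_assoc y), J_l.
    apply zero_r. }
  assert (ud : u · dom N = x).
  { apply (kernel_ob_mono kerK).
    rewrite comp_assoc, <- fun_dom, <- comp_assoc, uK, comp_assoc, fun_dom,
      <- comp_assoc, <- hd, comp_assoc, comparison_ob. reflexivity. }
  assert (uc : u · cod N = y).
  { apply (kernel_ob_mono kerK).
    rewrite comp_assoc, <- fun_cod, <- comp_assoc, uK, comp_assoc, fun_cod,
      <- comp_assoc, hc, comp_assoc, comparison_ob. reflexivity. }
  exists u. split.
  - split; [exact ud | split; [| exact uc]].
    apply (hkernel_arrow_mono hker).
    + rewrite comp_assoc, fun_dom, <- comp_assoc, ud. exact hd.
    + rewrite comp_assoc, fun_cod, <- comp_assoc, uc. symmetry. exact hc.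
    + rewrite comp_assoc, comparison_arrow. exact uK.
  - intros v [_ [vJ _]]. apply (kernel_arrow_mono kerK).
    rewrite uK, <- vJ, comp_assoc, comparison_arrow. reflexivity.
Qed.

(** An element [h : J x -> p] of the pullback, read in [A] as an arrow out of [x]
    with [F x = 0] and inverted, becomes an arrow whose image under [F] ends in
    [0]. *)
Lemma inverse_into_kernel :
  (pr2 (fun0 J) (dom P) · fun1 L · inv A) · (fun1 F · cod B) = zero _ _.
Proof.
  rewrite fun_cod, !comp_assoc,
    (square_assoc _ (eq_trans (inv_cod A) (eq_sym (comp_id_l _)))), comp_id_l,
    (square_assoc _ (fun_dom L)), <- (comp_assoc _ (dom P)), <- pr_square,
    !comp_assoc, (square_assoc _ (eq_trans comparison_ob (eq_sym (comp_id_l _)))),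
    comp_id_l, (kernel_ob_zero kerK). apply zero_r.
Qed.

Definition to_tau_domain :
    Hom (PB (fun0 J) (dom P)) (Ker (fun1 F · cod B)) :=
  ker_lift inverse_into_kernel.

Lemma hkernel_inv_cod : (l · inv B) · cod B = zero _ _.
Proof. rewrite comp_assoc, inv_cod. apply hkernel_dom. Qed.

Lemma hkernel_inv_square :
  fun0 L · fun0 F = ker_lift hkernel_inv_cod · (ker (cod B) · dom B).
Proof.
  rewrite <- comp_assoc, ker_lift_ker, comp_assoc, inv_dom, hkernel_cod.
  reflexivity.
Qed.

(** A path [0 -> F a] inverted gives an arrow of [Ker (cod B)] starting at
    [F a]. *)
Definition to_tau_codomain : Hom (ob0 P) (PB (fun0 F) (ker (cod B) · dom B)) :=
  pair hkernel_inv_square.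

Lemma to_tau_codomain_pr1 : to_tau_codomain · pr1 _ _ = fun0 L.
Proof. apply pair_pr1. Qed.

Lemma to_tau_codomain_pr2 : to_tau_codomain · (pr2 _ _ · ker (cod B)) = l · inv B.
Proof.
  rewrite <- comp_assoc. unfold to_tau_codomain. rewrite pair_pr2. apply ker_lift_ker.
Qed.

Lemma to_tau_domain_ker :
  to_tau_domain · ker (fun1 F · cod B) = pr2 (fun0 J) (dom P) · fun1 L · inv A.
Proof. apply ker_lift_ker. Qed.

Lemma to_tau_codomain_iso : IsIso to_tau_codomain.
Proof.
  apply iso_of_generalized_elements.
  - intros W u v E. apply (hkernel_ob_mono hker).
    + rewrite <- to_tau_codomain_pr1, <- !comp_assoc, E. reflexivity.
    + apply inv_mono. rewrite !comp_assoc, <- to_tau_codomain_pr2, <- !comp_assoc, E.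
      reflexivity.
  - intros W y.
    destruct (@hkernel_ob_lift _ _ _ _ _ _ _ hker W (y · pr1 _ _)
      (y · (pr2 _ _ · ker (cod B)) · inv B)) as [p [pL pl]].
    + rewrite !comp_assoc, inv_dom, ker_zero, !zero_r. reflexivity.
    + rewrite !comp_assoc, inv_cod, pr_square. reflexivity.
    + exists p. apply PB_unique.
      * rewrite comp_assoc, to_tau_codomain_pr1. exact pL.
      * apply ker_mono. rewrite !comp_assoc, to_tau_codomain_pr2, <- comp_assoc, pl.
        rewrite comp_assoc, inv_inv, comp_id_r. reflexivity.
Qed.

(** From [f : a -> x] with [F x = 0] one recovers [x] in the kernel, the target
    [p = (a, F f^-1)], and the arrow [f^-1 : J x -> p]. *)
Lemma to_tau_domain_iso : IsIso to_tau_domain.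
Proof.
  apply iso_of_generalized_elements.
  - intros W u v E.
    assert (EL : u · pr2 (fun0 J) (dom P) · fun1 L
                 = v · pr2 (fun0 J) (dom P) · fun1 L).
    { apply inv_mono. rewrite !(comp_assoc u), !(comp_assoc v), <- to_tau_domain_ker.
      rewrite <- !comp_assoc, E. reflexivity. }
    assert (sq : forall w : Hom W (PB (fun0 J) (dom P)),
      (w · pr2 (fun0 J) (dom P)) · dom P = (w · pr1 (fun0 J) (dom P)) · fun0 J).
    { intros w. rewrite !comp_assoc, pr_square. reflexivity. }
    assert (E1 : u · pr1 (fun0 J) (dom P) = v · pr1 (fun0 J) (dom P)).
    { apply (kernel_ob_mono kerK).
      rewrite <- comparison_ob, <- !comp_assoc, <- !sq, !comp_assoc, <- fun_dom,
        <- !comp_assoc, EL. reflexivity. }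
    apply PB_unique; [exact E1 |].
    apply (hkernel_arrow_mono hker); [| | exact EL].
    + rewrite !sq, E1. reflexivity.
    + apply (hkernel_ob_mono hker).
      * rewrite !comp_assoc, <- fun_cod, <- !comp_assoc, EL. reflexivity.
      * rewrite <- (arrow_from_kernel (sq u)), <- (arrow_from_kernel (sq v)), EL.
        reflexivity.
  - intros W y. set (f := y · ker (fun1 F · cod B)).
    assert (fz : f · fun1 F · cod B = zero _ _).
    { unfold f. rewrite !comp_assoc, ker_zero. apply zero_r. }
    destruct (@kernel_ob_lift _ _ _ _ _ _ kerK W (f · cod A)) as [x xK].
    { rewrite comp_assoc, <- fun_cod, <- comp_assoc. exact fz. }
    destruct (@hkernel_ob_lift _ _ _ _ _ _ _ hker W (f · dom A)
      (f · fun1 F · inv B)) as [p [pL pl]].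
    { rewrite comp_assoc, inv_dom. exact fz. }
    { rewrite !comp_assoc, inv_cod, fun_dom. reflexivity. }
    destruct (@hkernel_arrow_classified _ _ _ _ _ _ _ hker W (x · fun0 J) p
      (f · inv A)) as [h [[hd [hc hL]] _]].
    { rewrite !comp_assoc, inv_dom, comparison_ob. symmetry. exact xK. }
    { rewrite comp_assoc, inv_cod. symmetry. exact pL. }
    { rewrite pl, (comp_assoc x), J_l, zero_r, !comp_assoc, fun_inv.
      rewrite <- (zero_l W (unt B)). apply composite_unit_l.
      rewrite !comp_assoc, inv_dom, <- comp_assoc. exact fz. }
    exists (pair (eq_sym hd)). apply ker_mono.
    rewrite comp_assoc, to_tau_domain_ker, <- !comp_assoc, pair_pr2, hL, comp_assoc,
      inv_inv, comp_id_r. reflexivity.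
Qed.

(** The arrow testing essential surjectivity of [J] is [tau_d] up to inversion.
    On the second component this uses that the path at the target of [h] is
    [F h]. *)
Lemma tau_d_isomorphic :
  to_tau_domain · tau_d F = (pr2 (fun0 J) (dom P) · cod P) · to_tau_codomain.
Proof.
  apply PB_unique.
  - rewrite !comp_assoc, to_tau_codomain_pr1. unfold tau_d. rewrite pair_pr1.
    rewrite <- comp_assoc, to_tau_domain_ker, !comp_assoc, inv_dom, fun_cod.
    reflexivity.
  - apply ker_mono. rewrite !comp_assoc, to_tau_codomain_pr2.
    rewrite <- (comp_assoc (tau_d F)). unfold tau_d. rewrite pair_pr2.
    unfold F1c. rewrite ker_lift_ker, <- comp_assoc, to_tau_domain_ker.
    rewrite (comp_assoc _ (inv A)), fun_inv, <- comp_assoc.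
    rewrite (arrow_from_kernel (eq_sym (pr_square _ _))), comp_assoc, comp_assoc.
    reflexivity.
Qed.

End Comparison.

Unset Implicit Arguments.

Theorem proposition4p5 (C : PointedLexCategory) (regC : IsRegular C)
  (A B : Groupoid C) (F : Functor A B)
  (KerF : Groupoid C) (K_F : Functor KerF A) (kerF : IsKernelFunctor F K_F)
  (HKF : Groupoid C) (KF : Functor HKF A)
  (kF : NatTrans (zero_functor HKF B) (comp_functor KF F))
  (hkerF : IsStrongHKernel kF)
  (J : Functor KerF HKF)
  (J_KF : eq_functor (comp_functor J KF) K_F)
  (J_kF : fun0 J · kF = fun0 (zero_functor KerF B) · unt B) :
  (StarFibration F <-> WeakEquivalence J) /\
  (SplitEpiStarFibration F <-> Equivalence J).
Proof.
  assert (J_zero : fun0 J · kF = zero _ _).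
  { rewrite J_kF. exact (zero_l _ (unt B)). }
  pose proof (comparison_fully_faithful kerF hkerF J_KF J_zero) as ff.
  pose proof (to_tau_domain_iso kerF hkerF J_KF J_zero) as isop.
  pose proof (to_tau_codomain_iso hkerF) as isoq.
  pose proof (tau_d_isomorphic kerF J_KF J_zero) as sq.
  destruct (iso_square_sym isop isoq sq) as [p' [q' [isop' [isoq' sq']]]].
  split; split.
  - intros tau. split; [exact ff |].
    exact (regular_epi_along_iso isop' isoq' sq' tau).
  - intros [_ ess]. exact (regular_epi_along_iso isop isoq sq ess).
  - intros tau. apply (equivalence_of_split ff).
    exact (split_epi_along_iso isoq' sq' tau).
  - intros eqv. exact (split_epi_along_iso isoq sq (split_of_equivalence eqv)).
Qed.
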